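(* Let $\Phi$ be a real-valued continuously differentiable function with locally Lipschitz gradient on an open neighborhood of $\mathbb R_+^n=\{x\in\mathbb R^n:x\ge 0\}$. For each $i\in\{1,\dots,n\}$ let $g_i:\mathbb R\to(0,+\infty)$ be a $C^1$ increasing diffeomorphism with $g_i'(s)>0$ for every $s\in\mathbb R$, $\lim_{s\to-\infty}g_i(s)=0$ and $\lim_{s\to-\infty}g_i'(s)=0$, and write $g(u)=(g_1(u_1),\dots,g_n(u_n))$. Let $(u_k)_{k\ge0}\subset\mathbb R^n$ satisfy $$u_{k+1}-u_k+\eta_k\nabla\Phi(x_{k+1})=0,\qquad x_{k+1}=g(u_{k+1}),\qquad k\ge0,$$ where $\eta_k\ge\underline\eta>0$ for all $k$, for a fixed constant $\underline\eta$. If $x_k\to x^\star\in\mathbb R_+^n$, then $x^\star$ satisfies the KKT conditions of $\min_{x\ge0}\Phi(x)$, that is, $$x^\star\ge 0,\qquad \nabla\Phi(x^\star)\ge 0,\qquad x_i^\star\,\nabla_i\Phi(x^\star)=0\quad\text{for all }i.$$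
   Context: Vector inequalities are componentwise, and $\nabla_i\Phi$ denotes the $i$-th component of the Euclidean gradient. *)

(* Defs.v *)
From HB Require Import structures.
From mathcomp Require Import all_boot all_order all_algebra.
From mathcomp Require Import all_classical all_reals all_analysis.
Set Implicit Arguments.
Unset Strict Implicit.
Unset Printing Implicit Defensive.
Import Order.TTheory GRing.Theory Num.Theory.
Import numFieldNormedType.Exports.
Local Open Scope ring_scope.
Local Open Scope classical_set_scope.

Definition nonneg_orthant (R : realType) (n : nat) : set 'rV[R]_n :=
  [set x | forall i, 0 <= x 0 i].

Definition gradient (R : realType) (n : nat) (Phi : 'rV[R]_n -> R)
    (x : 'rV[R]_n) : 'rV[R]_n :=
  \row_i 'D_(delta_mx 0 i) Phi x.

(* Meant for an open [U]: differentiability and continuity of the gradient at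
   a point of [U] then only depend on the restriction of [Phi] to [U]. *)
Definition continuously_differentiable_on (R : realType) (n : nat)
    (U : set 'rV[R]_n) (Phi : 'rV[R]_n -> R) : Prop :=
  (forall x, U x -> differentiable Phi x) /\
  (forall x, U x -> {for x, continuous (gradient Phi)}).

(* Meant for an open [A], as above. *)
Definition C1_on (R : realType) (A : set R) (f : R -> R) : Prop :=
  (forall s, A s -> derivable f s 1) /\
  (forall s, A s -> {for s, continuous f^`()}).

Definition C1_diffeomorphism (R : realType) (A B : set R) (f : R -> R) : Prop :=
  [/\ set_bij A B f, C1_on A f &
      exists2 h : R -> R, (forall s, A s -> h (f s) = s) & C1_on B h].

Definition coordwise (R : realType) (n : nat) (g : 'I_n -> R -> R)
    (u : 'rV[R]_n) : 'rV[R]_n :=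
  \row_i g i (u 0 i).

(* Main.v *)
Require Import Defs.
From HB Require Import structures.
From mathcomp Require Import all_boot all_order all_algebra.
From mathcomp Require Import all_classical all_reals all_analysis.
From mathcomp Require Import lra.
Import Order.TTheory GRing.Theory Num.Theory.
Import numFieldNormedType.Exports.
Local Open Scope ring_scope.
Local Open Scope classical_set_scope.

(** The argument runs one coordinate at a time. Let [G] be the [i]-th partial
    derivative of [Phi] at [xstar]. The gradient is continuous there, so the
    partial derivatives met along the iteration tend to [G]; as the step sizes
    stay above [eta_low], a nonzero [G] makes the dual coordinate [u k 0 i] move
    by at least a fixed amount, in the direction opposite to the sign of [G], at
    every late step. It therefore tends to an infinity
    ([implicit_step_cvg_pinfty], [implicit_step_cvg_ninfty]).

    - If [G < 0], then [u k 0 i] tends to [+oo], and so does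
      [x k 0 i = g i (u k 0 i)] for [0 < k], since [g i] increases onto the positive
      half-line ([increasing_onto_pos_cvg_pinfty]). This contradicts the
      convergence of [x]; hence [0 <= G].
    - If [0 < G], then [u k 0 i] tends to [-oo], where [g i] tends to [0]; hence
      [xstar 0 i = 0], which is complementarity. *)

Lemma increment_cvg_pinfty (R : realType) (v : nat -> R) (c : R) :
    0 < c -> (\forall k \near \oo, v k + c <= v k.+1) ->
  v k @[k --> \oo] --> +oo.
Proof.
move=> c_gt0 [N _ Nv].
have lin m : v N + c *+ m <= v (N + m)%N.
  elim: m => [|m IHm]; first by rewrite mulr0n addr0 addn0.
  rewrite mulrSr addrA addnS; apply: le_trans (Nv (N + m)%N (leq_addr _ _)).
  by rewrite lerD2r.
rewrite -(cvg_shiftn N); apply/cvgryPge => A.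
have [m0 Am0] : exists m0, (A - v N) / c <= m0%:R.
  exists (Num.bound `|(A - v N) / c|).
  by apply: le_trans (ler_norm _) (ltW (archi_boundP _)).
exists m0 => // m /= m0m.
rewrite addnC; apply: le_trans (lin m); rewrite -lerBlDl.
rewrite -mulr_natl -ler_pdivrMr //; apply: le_trans Am0 _.
by rewrite ler_nat.
Qed.

(** Past the stage where [p] is below [G / 2], each step raises [v] by at least
    [eta_low * (- G / 2)]. *)
Lemma implicit_step_cvg_pinfty (R : realType) (v p eta : nat -> R)
    (eta_low G : R) :
    0 < eta_low -> (forall k, eta_low <= eta k) ->
    (forall k, v k.+1 - v k + eta k * p k = 0) ->
    p k @[k --> \oo] --> G -> G < 0 ->
  v k @[k --> \oo] --> +oo.
Proof.
move=> low_gt0 low step pG G_lt0.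
apply: (@increment_cvg_pinfty _ _ (eta_low * (- G / 2))).
  by rewrite mulr_gt0 //; lra.
have : \forall k \near \oo, p k < G / 2.
  by apply: (cvgr_lt G) => //; lra.
apply: filterS => k pk.
have : eta_low * (- G / 2) <= eta k * - p k.
  by apply: ler_pM => //; [exact: ltW | lra | lra].
by move: (step k); rewrite mulrN; lra.
Qed.

Lemma implicit_step_cvg_ninfty (R : realType) (v p eta : nat -> R)
    (eta_low G : R) :
    0 < eta_low -> (forall k, eta_low <= eta k) ->
    (forall k, v k.+1 - v k + eta k * p k = 0) ->
    p k @[k --> \oo] --> G -> 0 < G ->
  v k @[k --> \oo] --> -oo.
Proof.
move=> low_gt0 low step pG G_gt0; apply/cvgNry.
apply: (@implicit_step_cvg_pinfty _ _ (- p) eta eta_low (- G)) => //.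
- by move=> k; rewrite !fctE mulrN -!opprD step oppr0.
- exact: cvgN.
- by rewrite oppr_lt0.
Qed.

(** Since [f] is onto, each level [`|A| + 1] is the value of [f] at some [s],
    and monotonicity keeps [f] above that level beyond [s]. *)
Lemma increasing_onto_pos_cvg_pinfty (R : realType) (f : R -> R) :
    {homo f : s t / s < t} -> set_surj [set: R] `]0, +oo[ f ->
  f s @[s --> +oo] --> +oo.
Proof.
move=> f_incr f_surj; apply/cvgryPge => A.
have [s _ fs] : (f @` [set: R]) (`|A| + 1).
  by apply: f_surj; rewrite /= in_itv /= andbT ltr_pwDr.
have : \forall t \near +oo, s < t by apply: nbhs_pinfty_gt; exact: num_real.
apply: filterS => t /f_incr; rewrite fs => /ltW; apply: le_trans.
by rewrite (le_trans (ler_norm A)) // lerDl.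
Qed.

Theorem proposition5p2 (R : realType) (n : nat)
  (U : set 'rV[R]_n) (Phi : 'rV[R]_n -> R)
  (U_open : open U) (U_orthant : @nonneg_orthant R n `<=` U)
  (Phi_C1 : continuously_differentiable_on U Phi)
  (Phi_lip : [locally [lipschitz gradient Phi x | x in U]])
  (g : 'I_n -> R -> R)
  (g_diffeo : forall i, C1_diffeomorphism [set: R] `]0, +oo[ (g i))
  (g_incr : forall i, {homo g i : s t / s < t})
  (g_deriv_gt0 : forall i s, 0 < (g i)^`() s)
  (g_cvg0 : forall i, g i s @[s --> -oo] --> (0 : R))
  (g_deriv_cvg0 : forall i, (g i)^`() s @[s --> -oo] --> (0 : R))
  (eta : nat -> R) (eta_low : R) (eta_low_gt0 : 0 < eta_low)
  (eta_ge : forall k, eta_low <= eta k)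
  (u x : nat -> 'rV[R]_n)
  (u_step : forall k, u k.+1 - u k + eta k *: gradient Phi (x k.+1) = 0)
  (x_def : forall k, x k.+1 = coordwise g (u k.+1))
  (xstar : 'rV[R]_n) (xstar_ge0 : nonneg_orthant xstar)
  (x_cvg : x k @[k --> \oo] --> xstar) :
  [/\ forall i, 0 <= xstar 0 i,
      forall i, 0 <= gradient Phi xstar 0 i &
      forall i, xstar 0 i * gradient Phi xstar 0 i = 0].
Proof.
have xS_cvg : x k.+1 @[k --> \oo] --> xstar by rewrite (cvg_shiftS x).
have grad_cvg i : gradient Phi (x k.+1) 0 i @[k --> \oo] -->
    gradient Phi xstar 0 i.
  have grad_cont := Phi_C1.2 _ (U_orthant _ xstar_ge0).
  apply: (continuous_cvg _ (@coord_continuous _ _ _ 0 i _)).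
  exact: (continuous_cvg _ grad_cont).
have coord_step i k :
    u k.+1 0 i - u k 0 i + eta k * gradient Phi (x k.+1) 0 i = 0.
  by have /rowP /(_ i) := u_step k; rewrite !mxE.
have coord_cvg i : g i (u k.+1 0 i) @[k --> \oo] --> xstar 0 i.
  have -> : (fun k => g i (u k.+1 0 i)) = (fun k => x k.+1 0 i).
    by apply/funext => k; rewrite x_def mxE.
  exact: (continuous_cvg _ (@coord_continuous _ _ _ 0 i _)).
have grad_ge0 i : 0 <= gradient Phi xstar 0 i.
  rewrite leNgt; apply/negP => G_lt0.
  have u_pinfty := implicit_step_cvg_pinfty _ _ _ _ _ _ eta_low_gt0 eta_ge
    (coord_step i) (grad_cvg i) G_lt0.
  have [[_ _ g_surj] _ _] := g_diffeo i.
  have : g i (u k.+1 0 i) @[k --> \oo] --> +oo.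
    apply: (cvg_comp (fun k => u k.+1 0 i) _ _
      (increasing_onto_pos_cvg_pinfty _ _ (g_incr i) g_surj)).
    by rewrite (cvg_shiftS (fun k => u k 0 i)).
  move/cvgryPgt => /(_ (xstar 0 i + 1)) g_gt.
  have g_lt : \forall k \near \oo, g i (u k.+1 0 i) < xstar 0 i + 1.
    by apply: (cvgr_lt _ (coord_cvg i)); rewrite ltrDl.
  have [k [gt_k lt_k]] := filter_ex (filterI g_gt g_lt).
  by have := lt_trans gt_k lt_k; rewrite ltxx.
split=> // i.
have [G_gt0|] := ltP 0 (gradient Phi xstar 0 i); last first.
  move=> G_le0; have -> : gradient Phi xstar 0 i = 0.
    by apply: le_anti; rewrite G_le0 grad_ge0.
  by rewrite mulr0.
have u_ninfty := implicit_step_cvg_ninfty _ _ _ _ _ _ eta_low_gt0 eta_ge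
  (coord_step i) (grad_cvg i) G_gt0.
have g_to0 : g i (u k.+1 0 i) @[k --> \oo] --> (0 : R).
  apply: (cvg_comp (fun k => u k.+1 0 i) _ _ (g_cvg0 i)).
  by rewrite (cvg_shiftS (fun k => u k 0 i)).
by rewrite (cvg_unique _ (coord_cvg i) g_to0) ?mul0r.
Qed.
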